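(* Let $Q=(q_n)_{n=1}^\infty$ be any sequence of integers with $q_n\geq 2$ for all $n$. For any sequence $\alpha=(\alpha_i)_{i=1}^\infty$ of nonnegative real numbers, $$\mathrm{HD}\big(\mathcal{D}_\infty^Q(\alpha)\big)=b_Q(\alpha)=\limsup_{n\to\infty}\frac{\log(q_1\cdots q_n)}{\log(q_1\cdots q_n)+\alpha(n)}.$$
   Context: $\mathrm{HD}$ denotes Hausdorff dimension. Let $X=\mathbb{R}/\mathbb{Z}$, and for $x\in X$ let $\|x\|$ denote the distance to the nearest integer. For a sequence $Q=(q_n)_{n=1}^\infty$ of integers $q_n\geq 2$ and $n\geq 1$, define $T_Q^n:X\to X$ by $T_Q^n(x)=q_n q_{n-1}\cdots q_1 x \pmod 1$. For a sequence $\alpha=(\alpha_i)_{i=1}^\infty$ of nonnegative real numbers put $\alpha(n)=\sum_{i=1}^n\alpha_i$, and define $$\mathcal{D}_\infty^Q(\alpha)=\{x\in X:\ \|T_Q^n(x)\|\leq e^{-\alpha(n)}\text{ for infinitely many } n\}.$$ For $s\geq 0$ the (upper) pressure function is $$P_{Q,\alpha}(s)=\limsup_{n\to\infty}\frac1n\big[(1-s)\log(q_1\cdots q_n)-s\,\alpha(n)\big]\in[-\infty,\infty],$$ and $$b_Q(\alpha)=\sup\{t\geq 0: P_{Q,\alpha}(t)>0\}=\inf\{t\geq 0: P_{Q,\alpha}(t)<0\}$$ (the two expressions coincide). *)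

(* Defs.v *)
From HB Require Import structures.
From mathcomp Require Import all_boot all_order all_algebra.
From mathcomp Require Import all_classical all_reals all_analysis.
From mathcomp Require Import generic_quotient ring_quotient ring lra.

Set Implicit Arguments.
Unset Strict Implicit.
Unset Printing Implicit Defensive.

Import Order.TTheory GRing.Theory Num.Theory.
Import numFieldNormedType.Exports.

Local Open Scope classical_set_scope.
Local Open Scope ring_scope.
Local Open Scope quotient_scope.

Section Hausdorff.
Context {R : realType} {T : metricType R}.
Implicit Types (s delta : R) (A U : set T).

(* Equal to [-oo] on the empty set, which [diam_pow] treats separately. *)
Definition diam A : \bar R :=
  ereal_sup [set (mdist x y)%:E | x in A & y in A].

(* The empty set has weight 0 for all s; a point has weight 0^0 = 1 if s = 0. *)
Definition diam_pow s U : \bar R :=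
  if `[< U = set0 >] then 0%E else poweR (diam U) s.

Definition hausdorff_premeasure s delta A : \bar R :=
  ereal_inf [set (\sum_(0 <= i <oo) diam_pow s (U i))%E
            | U in [set U : nat -> set T
                   | A `<=` \bigcup_i U i
                     /\ forall i, (diam (U i) <= delta%:E)%E]].

Definition hausdorff_measure s A : \bar R :=
  ereal_sup [set hausdorff_premeasure s delta A | delta in [set d : R | 0 < d]].

Definition hausdorff_dim A : \bar R :=
  ereal_inf [set s%:E | s in [set s : R | 0 <= s /\ hausdorff_measure s A = 0%E]].

End Hausdorff.

Section IntDist.
Context {R : realType}.
Implicit Types (r : R) (k : int).

Definition int_dist r : R := inf [set `|r - k%:~R| | k in [set: int]].

Lemma int_dist_le r k : int_dist r <= `|r - k%:~R|.
Proof.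
apply: ge_inf; last by exists k.
by exists 0 => _ [l _ <-].
Qed.

Lemma int_dist_nearest r : exists k, int_dist r = `|r - k%:~R|.
Proof.
pose f := Num.floor r.
have fr : f%:~R <= r by exact: Num.Theory.floor_le.
have rf : r <= (f + 1)%:~R by rewrite ltW// floorD1_gt.
have low k : Num.min `|r - f%:~R| `|r - (f + 1)%:~R| <= `|r - k%:~R|.
  rewrite ge_min; have [kf|fk] := leP k f; apply/orP; [left|right].
    have kf' : k%:~R <= f%:~R :> R by rewrite ler_int.
    by rewrite !ger0_norm ?subr_ge0 ?lerD2l ?lerN2// (le_trans kf').
  have fk' : (f + 1)%:~R <= k%:~R :> R by rewrite ler_int lezD1.
  by rewrite !ler0_norm ?subr_le0 ?opprB ?lerD2r// (le_trans rf).
have ge : Num.min `|r - f%:~R| `|r - (f + 1)%:~R| <= int_dist r.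
  by apply: lb_le_inf; [exists `|r - 0%:~R|, 0|move=> _ [k _ <-]].
have [fle|fgt] := leP `|r - f%:~R| `|r - (f + 1)%:~R|.
  by exists f; apply/eqP; rewrite eq_le int_dist_le (le_trans _ ge)// le_min lexx.
exists (f + 1); apply/eqP; rewrite eq_le int_dist_le (le_trans _ ge)//.
by rewrite le_min lexx ltW.
Qed.

Lemma int_dist_ge0 r : 0 <= int_dist r.
Proof. by have [k ->] := int_dist_nearest r. Qed.

Lemma int_distDint r k : int_dist (r + k%:~R) = int_dist r.
Proof.
have H x l : int_dist (x + l%:~R) <= int_dist x.
  have [m ->] := int_dist_nearest x.
  have := int_dist_le (x + l%:~R) (m + l).
  by rewrite intrD opprD addrACA subrr addr0.
apply/eqP; rewrite eq_le H/=.
by have := H (r + k%:~R) (- k); rewrite intrN addrK.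
Qed.

Lemma int_distN r : int_dist (- r) = int_dist r.
Proof.
have H x : int_dist (- x) <= int_dist x.
  have [m ->] := int_dist_nearest x.
  by have := int_dist_le (- x) (- m); rewrite intrN -opprD normrN.
by apply/eqP; rewrite eq_le H/=; have := H (- r); rewrite opprK.
Qed.

Lemma int_distD r1 r2 : int_dist (r1 + r2) <= int_dist r1 + int_dist r2.
Proof.
have [k1 ->] := int_dist_nearest r1; have [k2 ->] := int_dist_nearest r2.
apply: le_trans (int_dist_le _ (k1 + k2)) _.
by rewrite intrD opprD addrACA ler_normD.
Qed.

End IntDist.

Section Circle.
Context {R : realType}.

Definition int_pred : {pred R} := fun x => x \is a Num.int.

Lemma int_pred_zmod_closed : zmod_closed int_pred.
Proof. by split=> [|x y]; [exact: rpred0|exact: rpredB]. Qed.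

HB.instance Definition _ := GRing.isZmodClosed.Build R int_pred int_pred_zmod_closed.

End Circle.

(* R / Z as the quotient of the additive group R by the subgroup of integers. *)
Definition circle (R : realType) : Type := {ideal_quot (@int_pred R)}.

HB.instance Definition _ (R : realType) := Choice.on (circle R).
HB.instance Definition _ (R : realType) := GRing.Zmodule.on (circle R).
HB.instance Definition _ (R : realType) := ZmodQuotient.on (circle R).

Section CircleMetric.
Context {R : realType}.
Implicit Types (x y z : circle R) (r : R).

Definition circle_norm x : R := int_dist (repr x).

Lemma circle_norm_pi r : circle_norm (\pi_(circle R) r) = int_dist r.
Proof.
rewrite /circle_norm.
have : (repr (\pi_(circle R) r) - r) \in @int_pred R.
  by rewrite Quotient.idealrBE reprK.
by case/intrP => k /eqP; rewrite subr_eq addrC => /eqP ->; exact: int_distDint.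
Qed.

Definition circle_dist x y : R := circle_norm (x - y).

Lemma circle_distxx x : circle_dist x x = 0.
Proof.
rewrite /circle_dist subrr -(raddf0 \pi_(circle R)) circle_norm_pi.
apply/eqP; rewrite eq_le int_dist_ge0 andbT.
by have := int_dist_le (0 : R) 0; rewrite subrr normr0.
Qed.

Lemma circle_dist_positivity x y : circle_dist x y = 0 -> x = y.
Proof.
rewrite -[x]reprK -[y]reprK /circle_dist -raddfB circle_norm_pi.
have [k ->] := int_dist_nearest (repr x - repr y).
move=> /normr0_eq0/eqP; rewrite subr_eq0 => /eqP xy.
by apply/eqP; rewrite -Quotient.idealrBE xy; exact: intr_int.
Qed.

Lemma circle_dist_sym x y : circle_dist x y = circle_dist y x.
Proof.
rewrite -[x]reprK -[y]reprK /circle_dist -!raddfB !circle_norm_pi.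
by rewrite -int_distN opprB.
Qed.

Lemma circle_dist_triangle y x z :
  circle_dist x z <= circle_dist x y + circle_dist y z.
Proof.
rewrite -[x]reprK -[y]reprK -[z]reprK /circle_dist -!raddfB !circle_norm_pi.
by rewrite -[leLHS](congr1 _ (subrKA (repr y) _ _)) int_distD.
Qed.

HB.instance Definition _ := isMetric.Build R (circle R)
  circle_distxx circle_dist_positivity circle_dist_sym circle_dist_triangle.

End CircleMetric.

Section Dynamics.
Context {R : realType}.
Implicit Types (q : nat -> nat) (alpha : nat -> R) (n : nat) (s : R).

(* Sequences are indexed from 1: the values [q 0] and [alpha 0] are never used. *)
Definition qprod q n : nat := (\prod_(1 <= i < n.+1) q i)%N.

Definition T_iter q n (x : circle R) : circle R := x *+ qprod q n.

Definition alpha_sum alpha n : R := \sum_(1 <= i < n.+1) alpha i.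

Definition D_infty q alpha : set (circle R) :=
  [set x | infinite_set [set n | (1 <= n)%N
             /\ circle_norm (T_iter q n x) <= expR (- alpha_sum alpha n)]].

(* The value at n = 0 (here 0) does not affect the limit superior. *)
Definition pressure q alpha s : \bar R :=
  limn_esup (fun n => (n%:R^-1 * ((1 - s) * ln (qprod q n)%:R
                                  - s * alpha_sum alpha n))%:E).

Definition bQ q alpha : \bar R :=
  ereal_sup [set t%:E | t in [set t : R | 0 <= t /\ (0 < pressure q alpha t)%E]].

Lemma qprod_ge q n : (forall i, (1 <= i)%N -> (2 <= q i)%N) -> (2 ^ n <= qprod q n)%N.
Proof.
move=> q2; rewrite /qprod; elim: n => [|n IH]; first by rewrite big_nil.
by rewrite big_nat_recr//= expnSr leq_mul// q2.
Qed.

Lemma alpha_sum_ge0 alpha n :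
  (forall i, (1 <= i)%N -> 0 <= alpha i) -> 0 <= alpha_sum alpha n.
Proof.
by move=> a0; rewrite /alpha_sum big_nat_cond sumr_ge0// => i /andP[/andP[/a0]].
Qed.

Lemma ln_qprod_ge q n : (forall i, (1 <= i)%N -> (2 <= q i)%N) ->
  n%:R * ln 2 <= ln (qprod q n)%:R :> R.
Proof.
move=> q2; rewrite mulr_natl -lnXn// -natrX ler_ln ?posrE ?ltr0n ?expn_gt0//.
  by rewrite ler_nat qprod_ge.
by rewrite (leq_trans _ (qprod_ge _ q2))// expn_gt0.
Qed.

Lemma pressure_gt0 q alpha : (forall i, (1 <= i)%N -> (2 <= q i)%N) ->
  (0 < pressure q alpha 0)%E.
Proof.
move=> q2; apply: (@lt_le_trans _ _ (ln 2)%:E); first by rewrite lte_fin ln_gt0// ltr1n.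
apply: le_ereal_inf_tmp => _ [V [N _ NV] <-].
apply: (@le_trans _ _ (((N.+1)%:R^-1 * ((1 - 0) * ln (qprod q N.+1)%:R
                                  - 0 * alpha_sum alpha N.+1))%:E)); last first.
  by apply: ereal_sup_ubound; exists N.+1 => //; apply: NV => /=.
by rewrite lee_fin subr0 mul1r mul0r subr0 ler_pdivlMl// ln_qprod_ge.
Qed.

Lemma pressure_lt0 q alpha s t :
    (forall i, (1 <= i)%N -> (2 <= q i)%N) ->
    (forall i, (1 <= i)%N -> 0 <= alpha i) ->
  s < t -> (pressure q alpha s <= 0)%E -> (pressure q alpha t < 0)%E.
Proof.
move=> q2 a0 st Ps.
have l2 : 0 < ln 2 :> R by rewrite ln_gt0// ltr1n.
pose c := (t - s) * ln 2; have c0 : 0 < c by rewrite mulr_gt0// subr_gt0.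
have : (pressure q alpha s < (c / 2)%:E)%E.
  by rewrite (le_lt_trans Ps)// lte_fin divr_gt0.
move=> /ereal_inf_lt[_ [V [N _ NV] <-]] Vc.
apply: (@le_lt_trans _ _ (- (c / 2))%:E); last by rewrite lte_fin oppr_lt0 divr_gt0.
apply: le_trans.
  apply: ereal_inf_lbound; exists [set n | (maxn N 1 <= n)%N] => //.
  by exists (maxn N 1).
apply: ge_ereal_sup => _ [n /= + <-]; rewrite geq_max => /andP[Nn n1].
have : ((n%:R^-1 * ((1 - s) * ln (qprod q n)%:R
                                  - s * alpha_sum alpha n))%:E <= ereal_sup
   [set (n%:R^-1 * ((1 - s) * ln (qprod q n)%:R - s * alpha_sum alpha n))%:E | n in V])%E.
  by apply: ereal_sup_ubound; exists n => //; apply: NV.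
move=> /le_lt_trans /(_ Vc); rewrite lte_fin lee_fin => u.
have n0 : 0 < n%:R :> R by rewrite ltr0n.
have -> : (1 - t) * ln (qprod q n)%:R - t * alpha_sum alpha n =
    ((1 - s) * ln (qprod q n)%:R - s * alpha_sum alpha n)
    - (t - s) * (ln (qprod q n)%:R + alpha_sum alpha n) :> R by ring.
have cn : c <= n%:R^-1 * ((t - s) * (ln (qprod q n)%:R + alpha_sum alpha n)).
  rewrite mulrCA ler_pM2l ?subr_gt0// ler_pdivlMl//.
  by rewrite (le_trans (ln_qprod_ge _ q2))// lerDl alpha_sum_ge0.
rewrite mulrBr; move: u cn; set X := _^-1 * _; set Y := _^-1 * _.
by lra.
Qed.

Lemma bQ_inf q alpha :
    (forall i, (1 <= i)%N -> (2 <= q i)%N) ->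
    (forall i, (1 <= i)%N -> 0 <= alpha i) ->
  bQ q alpha =
  ereal_inf [set t%:E | t in [set t : R | 0 <= t /\ (pressure q alpha t < 0)%E]].
Proof.
move=> q2 a0; apply/eqP; rewrite eq_le; apply/andP; split.
  apply: ge_ereal_sup => _ [a [_ Pa] <-].
  apply: le_ereal_inf_tmp => _ [b [_ Pb] <-].
  rewrite lee_fin leNgt; apply/negP => ba.
  by have := pressure_lt0 q2 a0 ba (ltW Pb); rewrite ltNge (ltW Pa).
have b0 : (0 <= bQ q alpha)%E.
  by apply: ereal_sup_ubound; exists 0 => //; split=> //; exact: pressure_gt0.
case E : (bQ q alpha) b0 => [b| |] // b0; last by rewrite leey.
rewrite lee_fin in b0.
apply/lee_addgt0Pr => e e0; rewrite -EFinD.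
apply: ereal_inf_lbound; exists (b + e) => //; split; first by rewrite addr_ge0// ltW.
apply: (@pressure_lt0 _ _ (b + e / 2)) => //.
  by rewrite ltrD2l ltr_pdivrMr// ltr_pMr// ltr1n.
rewrite leNgt; apply/negP => P0.
have : ((b + e / 2)%:E <= bQ q alpha)%E.
  apply: ereal_sup_ubound; exists (b + e / 2) => //; split=> //.
  by rewrite addr_ge0// divr_ge0// ltW.
by rewrite E lee_fin leNgt ltrDl divr_gt0.
Qed.

End Dynamics.

(* Main.v *)
(* Write L_n = q_1 ... q_n and r_n = exp (- alpha n) / L_n. A point lies in D_infty
   iff it is within r_n of some k / L_n for infinitely many n. If P(t) < 0 then
   \sum_n L_n r_n ^ t converges, so these balls have t-dimensional measure 0.
   If s < b_Q then L_n r_n ^ s is unbounded, so one can pick a sparse sequence (n_j)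
   with L_(n_(j+1)) r_(n_(j+1)) ^ s >= 2 / r_(n_j); keep, inside
   each interval [k / L_(n_j), k / L_(n_j) + r_(n_j)] already chosen, the intervals of
   the same form at level j + 1 given by an initial run of grid points k' / L_(n_(j+1)).
   This gives a Cantor set inside D_infty. The proportion of level-N intervals met by a ball of
   radius rho is at most 13 rho ^ s for N large, whence, by compactness, every cover
   has s-dimensional weight bounded below. *)

Require Import Defs.
From mathcomp Require Import all_boot all_order all_algebra.
From mathcomp Require Import all_classical all_reals all_analysis.
From mathcomp Require Import generic_quotient finmap ring lra zify.

Set Implicit Arguments.
Unset Strict Implicit.
Unset Printing Implicit Defensive.

Import Order.TTheory GRing.Theory Num.Theory.
Import numFieldNormedType.Exports.

Local Open Scope classical_set_scope.
Local Open Scope ring_scope.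
Local Open Scope quotient_scope.

(** * Limits superior of sequences *)

Section LimnEsup.
Context {R : realType}.
Implicit Types (u : nat -> \bar R) (x : \bar R).

Lemma lt_limn_esup u x : (x < limn_esup u)%E ->
  forall N, exists2 n, (N <= n)%N & (x < u n)%E.
Proof.
move=> xu N; have : (x < ereal_sup (u @` [set n | (N <= n)%N]))%E.
  apply: (lt_le_trans xu); apply: ereal_inf_lbound.
  by exists [set n | (N <= n)%N] => //; exists N.
by move=> /ereal_sup_gt[_ [n /= Nn <-] xn]; exists n.
Qed.

Lemma le_limn_esup u x :
  (forall N, exists2 n, (N <= n)%N & (x <= u n)%E) -> (x <= limn_esup u)%E.
Proof.
move=> xu; apply: le_ereal_inf_tmp => _ [V [N _ NV] <-].
have [n Nn xn] := xu N; apply: (le_trans xn).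
by apply: ereal_sup_ubound; exists n => //; exact: NV.
Qed.

Lemma limn_esup_lt u x : (limn_esup u < x)%E ->
  exists N, forall n, (N <= n)%N -> (u n < x)%E.
Proof.
move=> /ereal_inf_lt[_ [V [N _ NV] <-] Vx]; exists N => n Nn.
by apply: le_lt_trans Vx; apply: ereal_sup_ubound; exists n => //; exact: NV.
Qed.

End LimnEsup.

(** * Pressure and the growth of L_n r_n ^ s *)

Section Pressure.
Context {R : realType}.
Variables (q : nat -> nat) (alpha : nat -> R).
Hypothesis q2 : forall i, (1 <= i)%N -> (2 <= q i)%N.
Hypothesis a0 : forall i, (1 <= i)%N -> 0 <= alpha i.
Implicit Types (s t : R) (n : nat).

Lemma ln2_gt0 : 0 < ln 2 :> R.
Proof. by rewrite ln_gt0// ltr1n. Qed.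

(** Write L = log(q_1 ... q_n) and A = alpha(n). For n >= 1, (1 - t) L - t A > 0 means t < L / (L +
    A). Conversely, t' < t < L / (L + A) gives (1 - t') L - t' A >= (t - t') (L + A) >= (t - t') n
    log 2, so the pressure at t' is positive. *)
Lemma bQ_limn_esup : bQ q alpha =
  limn_esup (fun n => (ln (qprod q n)%:R
                       / (ln (qprod q n)%:R + alpha_sum alpha n))%:E).
Proof.
have l2 := ln2_gt0.
have Lpos n : (1 <= n)%N -> 0 < ln (qprod q n)%:R :> R.
  by move=> n1; rewrite (lt_le_trans _ (ln_qprod_ge n q2))// mulr_gt0// ltr0n.
have Apos n : 0 <= alpha_sum alpha n by exact: alpha_sum_ge0.
apply/eqP; rewrite eq_le; apply/andP; split.
  apply: ge_ereal_sup => _ [t [t0 Pt] <-]; apply: le_limn_esup => N.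
  have [n nN un] := lt_limn_esup Pt (maxn N 1).
  have [Nn n1] : (N <= n /\ 1 <= n)%N by move: nN; rewrite geq_max => /andP.
  exists n => //; move: un; rewrite lte_fin lee_fin pmulr_rgt0; last first.
    by rewrite invr_gt0 ltr0n.
  have := Lpos _ n1; have := Apos n.
  move: (ln _) (alpha_sum _ _) => L A A0 L0 H.
  by rewrite ler_pdivlMr; nra.
have ge0 : (0 <= bQ q alpha)%E.
  by apply: ereal_sup_ubound; exists 0 => //; split=> //; exact: pressure_gt0.
rewrite leNgt; apply/negP.
case E : (bQ q alpha) ge0 => [b| |]// b0; last by rewrite ltNge leey.
rewrite lee_fin in b0.
move=> H; have [t bt tu] : exists2 t, b < t &
    (t%:E < limn_esup (fun n => (ln (qprod q n)%:R
                       / (ln (qprod q n)%:R + alpha_sum alpha n))%:E))%E.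
  move: H; case: (limn_esup _) => [x| |]// H; last first.
    by exists (b + 1); rewrite ?ltrDl// ltry.
  exists ((b + x) / 2); rewrite ?lte_fin; move: H; rewrite lte_fin; lra.
have [t' [bt' t't]] : exists t', b < t' /\ t' < t by exists ((b + t) / 2); split; lra.
have : (t'%:E <= bQ q alpha)%E.
  apply: ereal_sup_ubound; exists t' => //; split; first lra.
  apply: (@lt_le_trans _ _ ((t - t') * ln 2)%:E).
    by rewrite lte_fin mulr_gt0// subr_gt0.
  apply: le_limn_esup => N.
  have [n nN un] := lt_limn_esup tu (maxn N 1).
  have [Nn n1] : (N <= n /\ 1 <= n)%N by move: nN; rewrite geq_max => /andP.
  exists n => //; move: un; rewrite lte_fin lee_fin.
  have := ln_qprod_ge n q2 (R := R); have := Lpos _ n1; have := Apos n.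
  have n0 : 0 < n%:R :> R by rewrite ltr0n.
  rewrite ler_pdivlMl//.
  move: (ln (qprod _ _)%:R) (alpha_sum _ _) => L A A0 L0 nL.
  rewrite ltr_pdivlMr; last lra.
  by move=> H1; nra.
by rewrite E lee_fin leNgt bt'.
Qed.

Definition radius n : R := expR (- alpha_sum alpha n) / (qprod q n)%:R.

Lemma qprod_gt0 n : (0 < qprod q n)%N.
Proof. by rewrite (leq_trans _ (qprod_ge n q2))// expn_gt0. Qed.

Lemma radius_gt0 n : 0 < radius n.
Proof. by rewrite divr_gt0 ?expR_gt0// ltr0n qprod_gt0. Qed.

Lemma radius_le n : radius n <= (qprod q n)%:R^-1.
Proof.
rewrite ler_pdivrMr ?ltr0n ?qprod_gt0// mulVf ?pnatr_eq0 -?lt0n ?qprod_gt0//.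
by rewrite -expR0 ler_expR oppr_le0 alpha_sum_ge0.
Qed.

Lemma radius_half n : radius n <= 2^-1 ^+ n.
Proof.
apply: le_trans (radius_le n) _; rewrite exprVn lef_pV2 ?posrE ?exprn_gt0//.
  by rewrite -natrX ler_nat qprod_ge.
by rewrite ltr0n qprod_gt0.
Qed.

(** The exponent is n times the n-th term of the pressure at [s]. *)
Lemma qprod_radius s n : (qprod q n)%:R * radius n `^ s =
  expR ((1 - s) * ln (qprod q n)%:R - s * alpha_sum alpha n).
Proof.
have L0 : 0 < (qprod q n)%:R :> R by rewrite ltr0n qprod_gt0.
rewrite /powR gt_eqF ?radius_gt0// lnM ?posrE ?expR_gt0 ?invr_gt0//.
rewrite expRK lnV ?posrE// -{1}[X in X * _](@lnK R) ?posrE// -expRD.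
by congr expR; ring.
Qed.

(** Lowering t to s adds (t - s) (log L_n + alpha(n)) >= (t - s) n log 2 to an exponent that is
    positive infinitely often at t. *)
Lemma qprod_radius_large s : (s%:E < bQ q alpha)%E ->
  forall (C : R) N, exists2 n, (N <= n)%N & C <= (qprod q n)%:R * radius n `^ s.
Proof.
move=> /ereal_sup_gt[_ [t [t0 Pt] <-]]; rewrite lte_fin => st C N.
have l2 := ln2_gt0; have c0 : 0 < (t - s) * ln 2 by rewrite mulr_gt0// subr_gt0.
have [n nN un] := lt_limn_esup Pt (maxn N (Num.truncn (C / ((t - s) * ln 2))).+1).
have [Nn Cn] : (N <= n /\ Num.truncn (C / ((t - s) * ln 2)) < n)%N.
  by move: nN; rewrite geq_max => /andP.
exists n => //; rewrite qprod_radius; apply: le_trans (expR_ge1Dx _).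
have n0 : (0 < n)%N by apply: leq_ltn_trans Cn.
move: un; rewrite lte_fin pmulr_rgt0 ?invr_gt0 ?ltr0n//.
have Cn' : C <= n%:R * ((t - s) * ln 2).
  rewrite -ler_pdivrMr//; case: (lerP 0 (C / ((t - s) * ln 2))) => C0; last first.
    by rewrite (le_trans (ltW C0)).
  by rewrite ltW// -truncn_lt_nat.
have := ln_qprod_ge n q2 (R := R); have := alpha_sum_ge0 n a0.
move: (ln (qprod _ _)%:R) (alpha_sum _ _) => L A A0 nL H.
nra.
Qed.

(** From some N on the terms of the pressure stay below some -c; multiplying by n gives geometric
    decay. *)
Lemma qprod_radius_small t : (pressure q alpha t < 0)%E ->
  exists c N, 0 < c /\ forall n, (N <= n)%N ->
    (qprod q n)%:R * radius n `^ t <= expR (- c) ^+ n.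
Proof.
move=> Pt; have [c c0 Pc] : exists2 c, 0 < c & (pressure q alpha t < (- c)%:E)%E.
  case: (pressure q alpha t) Pt => [x| |]//; last by exists 1; rewrite // ltNyr.
  by rewrite lte_fin => x0; exists (- x / 2); rewrite ?lte_fin; lra.
have [N HN] := limn_esup_lt Pc.
exists c, (maxn N 1); split=> // n; rewrite geq_max => /andP[Nn n1].
rewrite qprod_radius -expRM_natl ler_expR.
have := HN _ Nn; rewrite lte_fin => /ltW.
by rewrite ler_pdivrMl ?ltr0n.
Qed.

End Pressure.

(** * Hausdorff measure of sets covered in blocks *)

Section HausdorffCover.
Context {R : realType} {T : metricType R}.
Implicit Types (s rho delta : R) (A U : set T).

Lemma diam_le U rho : (forall x y, U x -> U y -> mdist x y <= rho) ->
  (diam U <= rho%:E)%E.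
Proof.
move=> H; apply: ge_ereal_sup => _ /= [x Ux [y Uy <-]].
by rewrite lee_fin H.
Qed.

Lemma mdist_le_diam U x y : U x -> U y -> ((mdist x y)%:E <= diam U)%E.
Proof. by move=> Ux Uy; apply: ereal_sup_ubound; exists x => //; exists y. Qed.

Lemma diam_ge0 U x : U x -> (0 <= diam U)%E.
Proof. by move=> Ux; have := mdist_le_diam Ux Ux; rewrite mdistxx. Qed.

Lemma diam_pow_ge0 s U : (0 <= diam_pow s U)%E.
Proof. by rewrite /diam_pow; case: asboolP => // _; exact: poweR_ge0. Qed.

Lemma diam_pow_le s rho U : 0 <= s -> 0 <= rho -> (diam U <= rho%:E)%E ->
  (diam_pow s U <= (rho `^ s)%:E)%E.
Proof.
move=> s0 rho0 Urho; rewrite /diam_pow; case: asboolP => [_|/eqP/set0P[x Ux]].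
  by rewrite lee_fin powR_ge0.
have := diam_ge0 Ux; case: (diam U) Urho => [d| |]//.
rewrite !lee_fin => drho d0.
by apply: ge0_ler_powR; rewrite ?nnegrE.
Qed.

Lemma diam_set0 : diam (set0 : set T) = -oo%E.
Proof.
rewrite /diam [X in ereal_sup X](_ : _ = set0) ?ereal_sup0//.
by apply/seteqP; split=> // z [x []].
Qed.

Lemma hausdorff_premeasure_le s delta A (W : nat -> nat -> set T)
    (K : nat -> nat) (rho : nat -> R) : 0 <= s ->
  (forall n, 0 <= rho n <= delta) ->
  (forall n k, (diam (W n k) <= (rho n)%:E)%E) ->
  (forall x, A x -> exists n k, (k < K n)%N /\ W n k x) ->
  (hausdorff_premeasure s delta A <= \sum_(n <oo) ((K n)%:R * rho n `^ s)%:E)%E.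
Proof.
move=> s0 rhod Wrho AW.
(* Indices beyond a block get the empty set, of weight 0 and diameter -oo, so that a bijection of
   nat with nat * nat enumerates the whole cover. *)
pose V n k := if (k < K n)%N then W n k else set0.
have /card_set_bijP[e' e'bij] : ([set: nat] #= [set: nat * nat])%card.
  by rewrite card_eq_sym card_nat2.
apply: (@le_trans _ _ (\sum_(i <oo) diam_pow s (V (e' i).1 (e' i).2))%E).
  apply: ereal_inf_lbound; exists (fun i => V (e' i).1 (e' i).2) => //=; split.
    move=> x /AW[n [k [kn Wx]]].
    have [_ _ /(_ (n, k) I)[i _ ei]] := e'bij.
    by exists i => //; rewrite ei /V /= kn.
  move=> i; rewrite /V; case: ifP => _; last by rewrite diam_set0 leNye.
  by apply: (le_trans (Wrho _ _)); rewrite lee_fin; case/andP: (rhod (e' i).1).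
rewrite nneseries_esumT; last by move=> i; exact: diam_pow_ge0.
rewrite -(@reindex_esum _ _ _ _ _ e' (fun p => diam_pow s (V p.1 p.2)) e'bij).
rewrite -setXTT.
rewrite (_ : [set: nat] `*` [set: nat] = [set: nat] `*`` (fun=> [set: nat])); last first.
  by apply/seteqP; split.
rewrite -(@esum_esum _ _ _ setT (fun=> setT) (fun n k => diam_pow s (V n k))); last first.
  by move=> *; exact: diam_pow_ge0.
rewrite nneseries_esumT; last by move=> n; rewrite lee_fin mulr_ge0// powR_ge0.
apply: le_esum => n _.
rewrite -nneseries_esumT; last by move=> k; exact: diam_pow_ge0.
rewrite (@nneseries_split _ _ 0 (K n)); last first.
  by move=> k _; exact: diam_pow_ge0.
rewrite add0n [X in (_ + X)%E]eseries0 ?adde0; last first.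
  move=> k Kk _; rewrite /V ltnNge Kk /= /diam_pow.
  by case: asboolP.
have -> : (K n)%:R * rho n `^ s = \sum_(0 <= i < K n) rho n `^ s.
  by rewrite sumr_const_nat subn0 mulr_natl.
rewrite -sumEFin.
rewrite big_nat [leRHS]big_nat; apply: lee_sum => k /andP[_ kK]; rewrite /V kK.
by apply: diam_pow_le => //; case/andP: (rhod n).
Qed.

Lemma hausdorff_measure_eq0 s A : 0 <= s ->
  (forall delta e, 0 < delta -> 0 < e -> (hausdorff_premeasure s delta A <= e%:E)%E) ->
  hausdorff_measure s A = 0%E.
Proof.
move=> s0 H; apply/eqP; rewrite eq_le; apply/andP; split.
  apply: ge_ereal_sup => _ [d /= d0 <-].
  by apply/lee_addgt0Pr => e e0; rewrite add0e H.
apply: ereal_sup_ge; exists (hausdorff_premeasure s 1 A).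
  by exists 1 => //=.
apply: le_ereal_inf_tmp => _ [U _ <-].
by apply: nneseries_ge0 => i _ _; exact: diam_pow_ge0.
Qed.

End HausdorffCover.

Lemma nneseries_geometric_le {R : realType} (a z : R) : 0 <= a -> 0 <= z < 1 ->
  (\sum_(n <oo) (a * z ^+ n)%:E <= (a / (1 - z))%:E)%E.
Proof.
move=> a0 /andP[z0 z1]; apply: lime_le.
  by apply: is_cvg_nneseries => n _ _; rewrite lee_fin mulr_ge0// exprn_ge0.
apply: nearW => m; rewrite sumEFin lee_fin.
have := @geometric_seriesE R a z; rewrite lt_eqF// => /(_ isT)/(congr1 (@^~ m)).
rewrite /series /= => ->.
rewrite ler_pM2r ?invr_gt0 ?subr_gt0// ler_piMr// lerBlDr lerDl.
by rewrite exprn_ge0.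
Qed.

Lemma infinite_natP (A : set nat) :
  infinite_set A <-> forall M, exists2 n, (M <= n)%N & A n.
Proof.
split=> [infA M|unbA /finite_fsetP[F AF]].
  apply: contrapT => H; apply: infA; apply: (sub_finite_set _ (finite_II M)) => n An /=.
  by rewrite ltnNge; apply/negP => Mn; apply: H; exists n.
have [n] := unbA (\max_(i <- F) i)%N.+1; rewrite AF /= => + nF.
by rewrite ltnNge => /negP; apply; exact: (@leq_bigmax_seq _ (enum_fset F) xpredT id).
Qed.

(** * Upper bound *)

Section UpperBound.
Context {R : realType}.
Variables (q : nat -> nat) (alpha : nat -> R).
Hypothesis q2 : forall i, (1 <= i)%N -> (2 <= q i)%N.
Hypothesis a0 : forall i, (1 <= i)%N -> 0 <= alpha i.

Lemma circle_dist_pi (r t : R) :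
  circle_dist (\pi_(circle R) r) (\pi_(circle R) t) = int_dist (r - t).
Proof. by rewrite /circle_dist -raddfB circle_norm_pi. Qed.

Lemma circle_norm_muln (r : R) n :
  circle_norm (\pi_(circle R) r *+ n) = int_dist (r *+ n).
Proof. by rewrite -raddfMn circle_norm_pi. Qed.

(** If p is an integer nearest to L x, then x - p / L = (L x - p) / L; reducing p modulo L moves p /
    L by an integer, so L centres suffice. *)
Lemma near_rational (x : circle R) (L : nat) : (0 < L)%N ->
  exists2 k, (k < L)%N &
    circle_dist x (\pi_(circle R) (k%:R / L%:R)) <= circle_norm (x *+ L) / L%:R.
Proof.
move=> L0; have LR : 0 < L%:R :> R by rewrite ltr0n.
rewrite -[x]reprK circle_norm_muln.
have [p ->] := int_dist_nearest (repr x *+ L).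
have Lz : (L%:Z != 0)%R by rewrite eqz_nat -lt0n.
have pL := divz_eq p L; have p0 := modz_ge0 p Lz; have pl : ((p %% L)%Z < L%:Z)%R by rewrite ltz_pmod.
case E : (p %% L)%Z p0 pl => [k|]// _ kL.
exists k; first by [].
rewrite circle_dist_pi.
have -> : repr x - k%:R / L%:R = repr x - p%:~R / L%:R + (p %/ L)%Z%:~R.
  by rewrite {1}pL E intrD intrM -!pmulrn mulrDl mulfK ?gt_eqF//; ring.
rewrite int_distDint (le_trans (int_dist_le _ 0))// subr0.
rewrite -{2}(@ger0_norm R L%:R)// -normrV ?unitfE ?gt_eqF// -normrM.
by rewrite mulrBl -(mulr_natr (repr x)) mulfK ?gt_eqF.
Qed.

(** For each M the balls of radius r_n about k / L_n with n >= M cover the set; their weight is at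
    most 2 ^ t times the sum of L_n r_n ^ t over n >= M, a small tail. *)
Lemma hausdorff_measure_D_infty0 t : 0 <= t -> (pressure q alpha t < 0)%E ->
  hausdorff_measure t (D_infty q alpha) = 0%E.
Proof.
move=> t0 Pt; apply: hausdorff_measure_eq0 => // delta e delta0 e0.
have [c [N [c0 cN]]] := qprod_radius_small q2 Pt.
pose z := expR (- c); have z01 : 0 <= z < 1.
  by rewrite expR_ge0 -expR0 ltr_expR oppr_lt0.
have z1 : 0 < 1 - z by rewrite subr_gt0; case/andP: z01.
(* [N1] keeps the diameters 2 r_n below delta, [N2] keeps the geometric tail below e. *)
have [N1 HN1] : exists N1, forall n, (N1 <= n)%N -> 2 * 2^-1 ^+ n <= delta.
  have : geometric 2 2^-1 @ \oo --> (0 : R).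
    by apply: cvg_geometric; rewrite ger0_norm// invf_lt1// ltr1n.
  move=> /cvgrPdist_le/(_ _ delta0)[N1 _ H]; exists N1 => n /H /=.
  by rewrite sub0r normrN ger0_norm// mulr_ge0// exprn_ge0// invr_ge0.
have [N2 HN2] : exists N2, forall n, (N2 <= n)%N -> 2 `^ t / (1 - z) * z ^+ n <= e.
  have : geometric (2 `^ t / (1 - z)) z @ \oo --> (0 : R).
    by apply: cvg_geometric; case/andP: z01 => z0 z1'; rewrite ger0_norm.
  move=> /cvgrPdist_le/(_ _ e0)[N2 _ H]; exists N2 => n /H /=.
  rewrite sub0r normrN ger0_norm// mulr_ge0//; last by rewrite exprn_ge0// expR_ge0.
  by rewrite divr_ge0 ?powR_ge0// ltW.
pose M := maxn N (maxn N1 N2).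
have [NM N1M N2M] : [/\ (N <= M)%N, (N1 <= M)%N & (N2 <= M)%N].
  by split; rewrite /M; lia.
have r0 n : 0 < radius q alpha n by exact: radius_gt0.
apply: (@le_trans _ _ (\sum_(n <oo) ((qprod q (n + M))%:R
    * (2 * radius q alpha (n + M)) `^ t)%:E)%E).
  apply: (@hausdorff_premeasure_le _ _ t delta (D_infty q alpha)
    (fun n k => [set x | circle_dist x (\pi_(circle R) (k%:R / (qprod q (n + M))%:R))
                         <= radius q alpha (n + M)])
    (fun n => qprod q (n + M)) (fun n => 2 * radius q alpha (n + M))) => //.
  - move=> n; apply/andP; split; first by rewrite mulr_ge0// ltW.
    apply: le_trans (HN1 (n + M)%N _); last by rewrite (leq_trans N1M)// leq_addl.
    by rewrite ler_pM2l// radius_half.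
  - move=> n k; apply: diam_le => x y /= xr yr.
    apply: (le_trans (circle_dist_triangle (\pi_(circle R) (k%:R / (qprod q (n + M))%:R)) _ _)).
    by rewrite [leRHS]mulr_natl [leRHS]mulr2n lerD// circle_dist_sym.
  - move=> x /infinite_natP/(_ M)[n Mn [n1 xn]].
    exists (n - M)%N; rewrite subnK//.
    have L0 := qprod_gt0 q2 n; have [k kL xk] := near_rational x L0.
    exists k; split=> //; apply: (le_trans xk).
    by rewrite /radius ler_pM2r ?invr_gt0 ?ltr0n.
apply: (@le_trans _ _ (\sum_(n <oo) ((2 `^ t * z ^+ M) * z ^+ n)%:E)%E).
  apply: lee_nneseries => n _; rewrite lee_fin ?mulr_ge0 ?powR_ge0//.
  rewrite powRM ?(ltW (r0 _))// mulrCA -mulrA ler_pM2l ?powR_gt0// -exprD (addnC M).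
  by rewrite cN// (leq_trans NM)// leq_addl.
apply: (le_trans (nneseries_geometric_le _ z01)).
  by rewrite mulr_ge0 ?powR_ge0// exprn_ge0// expR_ge0.
by rewrite lee_fin mulrAC HN2.
Qed.

End UpperBound.

(** * The Cantor set *)

Lemma count_allpairs_le (S T U : eqType) (f : S -> T -> U) (P : pred U) (Q : pred S)
    (s : seq S) (t : seq T) : (forall x y, y \in t -> P (f x y) -> Q x) ->
  (count P [seq f x y | x <- s, y <- t] <= size t * count Q s)%N.
Proof.
move=> PQ; elim: s => [|x s IH] //=; rewrite count_cat mulnDr leq_add//.
case: (boolP (Q x)) => [_|Qx].
  by rewrite muln1 -(size_map (f x)) count_size.
rewrite muln0 leqNgt -has_count; apply/hasPn => _ /mapP[y yt ->].
by apply: contra Qx; exact: PQ.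
Qed.

(** With k0 the least element, all elements lie among the integers from k0 to k0 + [truncn w]. *)
Lemma size_window {R : realType} (s : seq nat) (w : R) : 0 <= w -> uniq s ->
  {in s &, forall k k', k%:R - k'%:R < w} -> (size s)%:R <= w + 1.
Proof.
move=> w0 us sw; case: (posnP (size s)) => [->|s0]; first by rewrite addr_ge0.
have exs : exists k, k \in s by exists (nth 0%N s 0); rewrite mem_nth.
case: (ex_minnP exs) => k0 k0s k0min.
have : (size s <= size (iota k0 (Num.truncn w).+1))%N.
  apply: uniq_leq_size => // k ks; rewrite mem_iota (k0min _ ks)/= addnS ltnS.
  rewrite -leq_subLR truncn_ge_nat// natrB ?k0min// ltW//; exact: sw.
rewrite size_iota => /leq_trans sz; rewrite (@le_trans _ _ (Num.truncn w).+1%:R)//.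
  by rewrite ler_nat sz.
by rewrite -natr1 lerD2r truncn_le.
Qed.

(* At level [j] the node [k] stands for the interval of length [l j] starting at [k / L j]. *)
Section CantorTree.
Context {R : realType}.
Variables (L : nat -> nat) (l : nat -> R).
Hypothesis L_gt0 : forall j, (0 < L j)%N.
Hypothesis L_dvd : forall j, (L j %| L j.+1)%N.
Hypothesis l_gt0 : forall j, 0 < l j.
Hypothesis l_le : forall j, l j <= (L j)%:R^-1.
Hypothesis lL_ge1 : forall j, 1 <= l j * (L j.+1)%:R.
Implicit Types (i j k N : nat) (y rho s x : R).

(** How many full grid steps 1 / L_(j+1) fit into an interval of length l_j. *)
Definition branching j : nat := Num.truncn (l j * (L j.+1)%:R).

(** Node k of level i starts at index k L_(i+1) / L_i of the next grid; its children are the first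
    [branching i] grid points from there. *)
Fixpoint nodes j : seq nat :=
  if j is i.+1
  then [seq (k * (L i.+1 %/ L i) + a)%N | k <- nodes i, a <- iota 0 (branching i)]
  else [:: 0%N].

Definition left_end j k : R := k%:R / (L j)%:R.

Let LR j : 0 < (L j)%:R :> R. Proof. by rewrite ltr0n. Qed.

Lemma branching_le j : (branching j)%:R <= l j * (L j.+1)%:R.
Proof. by rewrite truncn_le mulr_ge0// ltW. Qed.

Lemma branching_gt0 j : (0 < branching j)%N.
Proof. by rewrite truncn_gt_nat. Qed.

Lemma branching_ge j : l j * (L j.+1)%:R <= 2 * (branching j)%:R.
Proof.
have lL0 : 0 <= l j * (L j.+1)%:R by rewrite mulr_ge0// ltW.
have := truncn_itv lL0 => /andP[_]; rewrite -/(branching j) -natr1.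
have : 1 <= (branching j)%:R :> R by rewrite ler1n branching_gt0.
lra.
Qed.

Lemma natr_ratio j : (L j.+1 %/ L j)%N%:R = (L j.+1)%:R / (L j)%:R :> R.
Proof. by rewrite -{2}(divnK (L_dvd j)) natrM mulfK ?gt_eqF. Qed.

Lemma branching_ratio j : (branching j <= L j.+1 %/ L j)%N.
Proof.
rewrite -(ler_nat R) natr_ratio (le_trans (branching_le j))// mulrC.
by rewrite ler_pM2l.
Qed.

Lemma size_nodes j : size (nodes j.+1) = (size (nodes j) * branching j)%N.
Proof. by rewrite /= size_allpairs size_iota. Qed.

Lemma size_nodes_gt0 j : (0 < size (nodes j))%N.
Proof. by elim: j => // j IH; rewrite size_nodes muln_gt0 IH branching_gt0. Qed.

(** Parent and offset are the quotient and remainder of the index by L_(j+1) / L_j, since offsets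
    stay below that ratio. *)
Lemma uniq_nodes j : uniq (nodes j).
Proof.
elim: j => // j IH /=; apply: allpairs_uniq => //; first exact: iota_uniq.
have d0 : (0 < L j.+1 %/ L j)%N by rewrite divn_gt0// dvdn_leq.
move=> _ _ /allpairsP[[k a] [/= _ + ->]] /allpairsP[[k' a'] [/= _ + ->]].
rewrite !mem_iota /= !add0n => am a'm /= e.
have lt b : (b < branching j)%N -> (b < L j.+1 %/ L j)%N.
  by move=> /leq_trans; apply; exact: branching_ratio.
have e1 := congr1 (divn^~ (L j.+1 %/ L j)%N) e.
have e2 := congr1 (modn^~ (L j.+1 %/ L j)%N) e.
move: e1 e2; rewrite /= !divnMDl// !(divn_small (lt _ _))// !addn0 => ->.
by rewrite !modnMDl !modn_small ?lt// => ->.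
Qed.

(** Since l_(j+1) <= 1 / L_(j+1), the child ends at offset at most (a + 1) / L_(j+1) <=
    [branching j] / L_(j+1) <= l_j. *)
Lemma child_cell j k a : (a < branching j)%N -> let k' := (k * (L j.+1 %/ L j) + a)%N in
  left_end j k <= left_end j.+1 k' /\ left_end j.+1 k' + l j.+1 <= left_end j k + l j.
Proof.
move=> am /=.
have -> : left_end j.+1 (k * (L j.+1 %/ L j) + a) = left_end j k + a%:R / (L j.+1)%:R.
  rewrite /left_end natrD natrM natr_ratio mulrDl; congr (_ + _).
  by field; rewrite !gt_eqF.
split; first by rewrite lerDl divr_ge0// ltW.
rewrite -addrA lerD2l (@le_trans _ _ (a.+1%:R / (L j.+1)%:R))//.
  by rewrite -natr1 mulrDl lerD2l mul1r l_le.
by rewrite ler_pdivrMr// (le_trans _ (branching_le j))// ler_nat.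
Qed.

Definition hits y rho j k : bool :=
  (left_end j k < y + rho) && (y - rho < left_end j k + l j).

Lemma count_hits_child y rho j : (count (hits y rho j.+1) (nodes j.+1)
  <= branching j * count (hits y rho j) (nodes j))%N.
Proof.
rewrite -[X in (_ <= X * _)%N](size_iota 0); apply: count_allpairs_le => k a.
rewrite mem_iota /= add0n => /(child_cell k)/= [h1 h2] /andP[h3 h4].
by apply/andP; split; [exact: le_lt_trans h3|exact: lt_le_trans h2].
Qed.

(** Hit nodes have left ends in ]y - rho - l_j, y + rho[, on a grid of spacing 1 / L_j. *)
Lemma count_hits_window y rho j : 0 < rho ->
  (count (hits y rho j) (nodes j))%:R <= (2 * rho + l j) * (L j)%:R + 1.
Proof.
move=> rho0; rewrite -size_filter; apply: size_window.
- by rewrite mulr_ge0 ?(ltW (LR j))// addr_ge0 ?(ltW (l_gt0 j))// mulr_ge0// ltW.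
- by rewrite filter_uniq// uniq_nodes.
move=> k k'; rewrite !mem_filter => /andP[/andP[h1 _] _] /andP[/andP[_ h2] _].
rewrite -ltr_pdivrMr// mulrBl.
by move: h1 h2; rewrite /left_end; lra.
Qed.

(** All nodes of a level have equally many children, so the proportion of hit nodes cannot grow with
    the level: a bound at one level passes to all later ones. *)
Lemma count_hits_le y rho j N (C : R) : (j <= N)%N ->
  (count (hits y rho j) (nodes j))%:R <= C * (size (nodes j))%:R ->
  (count (hits y rho N) (nodes N))%:R <= C * (size (nodes N))%:R.
Proof.
move=> jN Hj; elim: N jN => [|N IH]; first by rewrite leqn0 => /eqP <-.
rewrite leq_eqVlt => /predU1P[<-//|]; rewrite ltnS => /IH{}IH.
apply: (@le_trans _ _ (branching N * count (hits y rho N) (nodes N))%N%:R).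
  by rewrite ler_nat count_hits_child.
rewrite size_nodes [leRHS](_ : _ = (branching N)%:R * (C * (size (nodes N))%:R)).
  by rewrite natrM ler_pM2l ?ltr0n ?branching_gt0.
by rewrite natrM; ring.
Qed.

Hypothesis l0 : l 0%N = 2^-1.
Hypothesis l_lim : forall e : R, 0 < e -> exists j, l j <= e.

(** * Mass distribution on the Cantor tree *)

Section Frostman.
Variable s : R.
Hypothesis s01 : 0 <= s <= 1.
Hypothesis l_s : forall j, 2 <= l j * (L j.+1)%:R * l j.+1 `^ s.

(** The last branching alone gives at least l_j L_(j+1) / 2 nodes; [l_s] does the rest. *)
Lemma size_nodes_ge j : 1 <= (size (nodes j.+1))%:R * l j.+1 `^ s.
Proof.
have M0 : 1 <= (size (nodes j))%:R :> R by rewrite ler1n size_nodes_gt0.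
rewrite size_nodes natrM.
have := l_s j; have := branching_ge j; have := powR_gt0 s (l_gt0 j.+1).
move: (l j.+1 `^ s) (l j * _) (branching j)%:R (size (nodes j))%:R M0 => p X b M M1 p0 Xb.
move=> Xp; have bp : 1 <= b * p by nra.
by rewrite -mulrA; nra.
Qed.

Lemma half_le_powR : 2^-1 <= (2^-1 : R) `^ s.
Proof.
have [_ s1] := andP s01; apply: ger1_powR => //.
by rewrite invr_gt0 invf_le1// ler1n ltr0n.
Qed.

(** Let j be the first level with l_j <= rho, and M_j its number of nodes. For j > 0 at most 3 rho
    L_j + 1 nodes are hit; 3 rho L_j <= 12 rho ^ s M_j and 1 <= rho ^ s M_j add up to 13. *)
Lemma count_hits_frostman y rho : 0 < rho -> exists j, forall N, (j <= N)%N ->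
  (count (hits y rho N) (nodes N))%:R <= 13 * rho `^ s * (size (nodes N))%:R.
Proof.
move=> rho0; have [s0 s1] := andP s01.
case: (ex_minnP (l_lim rho0)) => j lj jmin.
exists j => N jN; apply: count_hits_le jN _.
have rs0 : 0 < rho `^ s by exact: powR_gt0.
case: j lj jmin => [|i] lj jmin.
  (* Level 0 has a single node, and rho >= 1/2 makes 13 rho ^ s at least 13/2. *)
  rewrite (@le_trans _ _ 1)//=; first by rewrite addn0 lern1 leq_b1.
  have : (2^-1 : R) `^ s <= rho `^ s.
    by apply: ge0_ler_powR => //; rewrite ?nnegrE -?l0// ?(ltW rho0) ?(ltW (l_gt0 0)).
  by have := half_le_powR; lra.
have rl : rho < l i.
  by rewrite ltNge; apply/negP => /jmin; rewrite ltnn.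
have w : (count (hits y rho i.+1) (nodes i.+1))%:R <= 3 * rho * (L i.+1)%:R + 1.
  apply: (le_trans (count_hits_window _ _ rho0)); rewrite lerD2r ler_pM2r//; lra.
have one : 1 <= (size (nodes i.+1))%:R * rho `^ s.
  apply: (le_trans (size_nodes_ge i)); rewrite ler_pM2l ?ltr0n ?size_nodes_gt0//.
  by apply: ge0_ler_powR; rewrite ?nnegrE// ltW.
(* [rho / l i <= (rho / l i) ^ s] since [rho < l i] and [s <= 1]. *)
have rls : rho * l i `^ s <= l i * rho `^ s.
  have q01 : 0 < rho / l i <= 1 by rewrite divr_gt0//= ler_pdivrMr// mul1r ltW.
  have := ger1_powR q01 s1; rewrite powRM ?invr_ge0 ?(ltW rho0) ?(ltW (l_gt0 i))//.
  have -> : (l i)^-1 `^ s = (l i `^ s)^-1.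
    by rewrite -powR_inv1 ?(ltW (l_gt0 i))// powRAC powR_inv1 ?powR_ge0.
  by rewrite ler_pdivrMr// mulrAC ler_pdivlMr ?powR_gt0// [leRHS]mulrC.
have half : 2^-1 <= (size (nodes i))%:R * l i `^ s.
  case: (i) => [|i']; first by rewrite mul1r l0 half_le_powR.
  by rewrite (le_trans _ (size_nodes_ge i'))// invf_le1// ler1n.
apply: (le_trans w).
(* Here 12 = 3 * 2 * 2, with one factor 2 from [half] and one from [branching_ge]. *)
have : 3 * rho * (L i.+1)%:R <= 12 * rho `^ s * (size (nodes i.+1))%:R.
  rewrite size_nodes natrM.
  have M0 : 0 < (size (nodes i))%:R :> R by rewrite ltr0n size_nodes_gt0.
  have LL := LR i.+1; have li := l_gt0 i.
  have bb := branching_ge i; have ls0 := powR_gt0 s li.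
  have step1 : rho <= 2 * ((size (nodes i))%:R * (l i * rho `^ s)).
    apply: (@le_trans _ _ (2 * ((size (nodes i))%:R * (rho * l i `^ s)))).
      by move: half; move: (size _)%:R (l i `^ s) => M p; nra.
    by rewrite ler_pM2l// ler_pM2l.
  apply: (@le_trans _ _ (3 * (2 * ((size (nodes i))%:R * (l i * rho `^ s))) * (L i.+1)%:R)).
    by rewrite ler_pM2r// ler_pM2l.
  rewrite [leLHS](_ : _ = (6 * rho `^ s * (size (nodes i))%:R) * (l i * (L i.+1)%:R)); last by ring.
  rewrite [leRHS](_ : _ = (6 * rho `^ s * (size (nodes i))%:R) * (2 * (branching i)%:R)); last by ring.
  by rewrite ler_pM2l// !mulr_gt0.
move: one; lra.
Qed.

End Frostman.

(** * Stages of the Cantor set and compactness *)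

Definition stage j : set R :=
  [set x | exists2 k, k \in nodes j & left_end j k <= x <= left_end j k + l j].

Lemma stage_closed j : closed (stage j).
Proof.
rewrite (_ : stage j =
    \bigcup_(k in [set` nodes j]) `[left_end j k, left_end j k + l j]%classic).
  by apply: closed_bigcup => [|k _]; [exact: finite_seq|exact: interval_closed].
by apply/seteqP; split=> x [k kj xk]; exists k => //=; rewrite ?in_itv// in xk *.
Qed.

Lemma stage_sub j N : (j <= N)%N -> stage N `<=` stage j.
Proof.
move=> jN; elim: N jN => [|N IH]; first by rewrite leqn0 => /eqP ->.
rewrite leq_eqVlt => /predU1P[->//|]; rewrite ltnS => /IH {}IH x.
move=> [_ /allpairsP[[k a] [/= kN + ->]]]; rewrite mem_iota /= add0n.
move=> /(child_cell k)/= [h1 h2] /andP[h3 h4]; apply: IH; exists k => //.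
by rewrite (le_trans h1)// (le_trans h4).
Qed.

Lemma stage_left_end j k : k \in nodes j -> stage j (left_end j k).
Proof. by move=> kj; exists k => //; rewrite lexx lerDl ltW. Qed.

Lemma stage0 : stage 0 = `[0, 2^-1]%classic.
Proof.
apply/seteqP; split=> x /=; rewrite in_itv /=.
  by move=> [k /=]; rewrite inE => /eqP ->; rewrite /left_end mul0r add0r l0.
by move=> xs; exists 0%N; rewrite ?inE// /left_end mul0r add0r l0.
Qed.

(** At a deep level N, ball i contains at most the proportion [w i] of the left ends, while finitely
    many balls together contain all of them. *)
Lemma cover_weight_ge1 s (y rho w : nat -> R) : 0 <= s <= 1 ->
  (forall j, 2 <= l j * (L j.+1)%:R * l j.+1 `^ s) ->
  (forall i, 0 <= w i) -> (forall i, 0 < rho i -> 13 * rho i `^ s <= w i) ->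
  (forall x, (forall j, stage j x) -> exists i, `|x - y i| < rho i) ->
  exists n, 1 <= \sum_(i < n) w i.
Proof.
move=> s01 l_s w0 rho_w cov.
(* The complements of the stages complete the balls to an open cover of
   [0, 1/2], so that finitely many balls already cover some stage. *)
have := @segment_compact R 0 2^-1; rewrite compact_cover.
move=> /(_ _ setT (fun i => `]y i - rho i, y i + rho i[%classic `|` ~` stage i)).
case=> [i _|x xs|D _ Dcov].
- by apply: openU; [exact: interval_open|apply: closed_openC; exact: stage_closed].
- case: (pselect (forall j, stage j x)) => [/cov[i xi]|/existsNP[i xi]].
    by exists i => //; left; rewrite /= in_itv /= -ltr_distl.
  by exists i => //; right.
(* As n exceeds every index in [D], a point of stage n avoids all the complements used and must lie
   in a ball. *)
pose n := (\max_(i <- enum_fset D) i)%N.+1.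
have ballcov x : stage n x -> exists2 i, (i < n)%N & y i - rho i < x < y i + rho i.
  move=> xn; have [|i iD] := Dcov x.
    by rewrite -stage0; exact: stage_sub xn.
  have lin : (i < n)%N by exact: (@leq_bigmax_seq _ (enum_fset D) xpredT id).
  by case=> [/=|/(_ (stage_sub (ltnW lin) xn))//]; rewrite in_itv; exists i.
pose inb i N k := y i - rho i < left_end N k < y i + rho i.
have /choice[J HJ] : forall i, exists j, forall N, (j <= N)%N ->
    (count (inb i N) (nodes N))%:R <= w i * (size (nodes N))%:R.
  move=> i; case: (ltP 0 (rho i)) => [rho0|rho0].
    have [j Hj] := count_hits_frostman s01 l_s (y i) rho0; exists j => N /Hj H.
    apply: (@le_trans _ _ (count (hits (y i) (rho i) N) (nodes N))%:R).
      rewrite ler_nat; apply: sub_count => k /andP[h1 h2].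
      by rewrite /hits h2 (lt_le_trans h1)// lerDl ltW.
    by apply: (le_trans H); rewrite ler_wpM2r// rho_w.
  exists 0%N => N _; rewrite [count _ _](_ : _ = 0%N) ?mulr_ge0//.
  apply/eqP; rewrite -leqn0 leqNgt -has_count; apply/hasPn => k _.
  by rewrite /inb; apply/negP => /andP[]; lra.
(* N >= n puts the left ends into stage n, which the balls cover; N >= J i makes each proportion
   bound available. *)
pose N := (maxn n (\max_(i < n) J i))%N.
exists n; rewrite -(@ler_pM2r _ (size (nodes N))%:R) ?ltr0n ?size_nodes_gt0//.
rewrite mul1r mulr_suml (@le_trans _ _ (\sum_(i < n) (count (inb i N) (nodes N))%:R))//.
  rewrite -natr_sum ler_nat.
  have : all (fun k => [exists i : 'I_n, inb i N k]) (nodes N).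
    apply/allP => k kN; have [|i lin xi] := ballcov (left_end N k).
      by apply: (@stage_sub _ N); [exact: leq_maxl|exact: stage_left_end].
    by apply/existsP; exists (Ordinal lin).
  elim: (nodes N) => //= k t IH /andP[/existsP[i ik] /IH{}IH].
  rewrite big_split /= -add1n leq_add//.
  by rewrite (bigD1 i)//= ik.
apply: ler_sum => i _; apply: HJ; rewrite /N leq_max; apply/orP; right.
exact: (@leq_bigmax _ (fun i : 'I_n => J i)).
Qed.

End CantorTree.

(** * Lower bound *)

(** Turns a set of diameter d into an open ball. For d > 0, rho = 2 d works as 2 ^ s <= 2; for d = 0
    < s, the slack e allows rho = e ^ (1 / s); for s = 0 both powers are 1. *)
Lemma powR_enlarge {R : realType} (s d e : R) : 0 <= s <= 1 -> 0 <= d -> 0 < e ->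
  exists2 rho, d < rho & rho `^ s <= 2 * d `^ s + e.
Proof.
move=> /andP[s0 s1] d0 e0; have [->|sN0] := eqVneq s 0.
  by exists (d + 1); rewrite ?ltrDl// !powRr0; lra.
move: d0; rewrite le_eqVlt => /predU1P[<-|d0].
  exists (e `^ s^-1); first by rewrite powR_gt0.
  by rewrite -powRrM mulVf// powRr1 ?(ltW e0)// powR0// mulr0 add0r.
exists (2 * d); first by lra.
have d2 : 0 < d `^ s by rewrite powR_gt0.
rewrite powRM ?(ltW d0)//; have : 2 `^ s <= 2 :> R by apply: ler1_powR; rewrite ?ler1n.
by nra.
Qed.

(** An integer k other than 0 has |r - k| >= |k| - |r| >= 1/2 >= |r|. *)
Lemma norm_le_int_dist {R : realType} (r : R) : `|r| <= 2^-1 -> `|r| <= int_dist r.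
Proof.
have [k ->] := int_dist_nearest r; have [->|k0] := eqVneq k 0.
  by rewrite subr0.
move=> r2; rewrite distrC (le_trans _ (lerB_dist _ _))//.
have : 1 <= `|k%:~R| :> R by rewrite norm_intr_ge1// ?intr_int// intr_eq0.
lra.
Qed.

Lemma sum_half_lt1 {R : realType} n : \sum_(i < n) (2^-1 : R) ^+ i.+1 <= 1.
Proof.
suff -> : \sum_(i < n) (2^-1 : R) ^+ i.+1 = 1 - 2^-1 ^+ n.
  by rewrite gerBl exprn_ge0.
elim: n => [|n IH]; first by rewrite big_ord0 expr0 subrr.
by rewrite big_ord_recr /= IH exprS; field.
Qed.

Section LowerBound.
Context {R : realType}.
Variables (q : nat -> nat) (alpha : nat -> R).
Hypothesis q2 : forall i, (1 <= i)%N -> (2 <= q i)%N.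
Hypothesis a0 : forall i, (1 <= i)%N -> 0 <= alpha i.
Implicit Types (s x : R) (n : nat).

Lemma bQ_le1 : (bQ q alpha <= 1)%E.
Proof.
apply: ge_ereal_sup => _ [t [t0 Pt] <-]; rewrite lee_fin leNgt; apply/negP => t1.
have [n _] := lt_limn_esup Pt 0%N; rewrite lte_fin ltNge => /negP; apply.
rewrite mulr_ge0_le0 ?invr_ge0//.
have : 0 <= ln (qprod q n)%:R :> R by rewrite ln_ge0// ler1n qprod_gt0.
have := alpha_sum_ge0 n a0; nra.
Qed.

Lemma qprod_dvd m n : (m <= n)%N -> (qprod q m %| qprod q n)%N.
Proof.
by move=> mn; rewrite /qprod (@big_cat_nat _ _ _ m.+1 1 n.+1)//= dvdn_mulr.
Qed.

(** Measure 0 would give a cover of weight below 1/104. Enlarged to balls with slacks of sum at most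
    1/52, finitely many weights sum to less than 13 (2/104 + 1/52) = 1/2, against the lower bound 1
    from the Cantor set. *)
Lemma hausdorff_measure_D_infty_neq0 s : 0 <= s -> (s%:E < bQ q alpha)%E ->
  hausdorff_measure s (D_infty q alpha) != 0%E.
Proof.
move=> s0 sb; apply/negP => /eqP Hs0.
have s1 : s <= 1 by have := le_trans (ltW sb) bQ_le1; rewrite lee_fin.
have s01 : 0 <= s <= 1 by rewrite s0.
(* The root gets length 1/2 in place of r_0 = 1: the Cantor set then stays in [0, 1/2], where the
   circle distance is |x - y|. *)
pose ell n : R := if n is 0%N then 2^-1 else radius q alpha n.
have ell_gt0 n : 0 < ell n by case: n => [|n]; rewrite ?invr_gt0//=; exact: radius_gt0.
have r_le1 n : radius q alpha n <= 1.
  by rewrite (le_trans (radius_half q2 a0 n))// exprn_ile1// invf_le1// ler1n.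
(* The next level comes from the unboundedness of L_n r_n ^ s. *)
have /choice[f Hf] : forall n, exists n', (n < n')%N /\
    2 <= ell n * (qprod q n')%:R * radius q alpha n' `^ s.
  move=> n; have [n' nn' Hn'] := qprod_radius_large q2 a0 sb (2 / ell n) n.+1.
  exists n'; split=> //; move: Hn'.
  by rewrite ler_pdivrMr// mulrC mulrA.
pose nn j := iter j f 0%N.
have nn_lt j : (nn j < nn j.+1)%N by have [] := Hf (nn j).
have nn_ge j : (j <= nn j)%N by elim: j => // j IH; exact: leq_ltn_trans (nn_lt j).
have ellS j : ell (nn j.+1) = radius q alpha (nn j.+1).
  by case: (nn j.+1) (nn_ge j.+1).
pose L j := qprod q (nn j); pose l j := ell (nn j).
have L_gt0 j : (0 < L j)%N by exact: qprod_gt0.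
have L_dvd j : (L j %| L j.+1)%N by apply: qprod_dvd; exact: ltnW.
have l_gt0 j : 0 < l j by exact: ell_gt0.
have l_le j : l j <= (L j)%:R^-1.
  case: j => [|j]; last by rewrite /l ellS; exact: radius_le.
  by rewrite /L /qprod /= big_geq// invr1 /l /= invf_le1// ler1n.
have l_s j : 2 <= l j * (L j.+1)%:R * l j.+1 `^ s.
  by rewrite [l j.+1]ellS; case: (Hf (nn j)).
have lL_ge1 j : 1 <= l j * (L j.+1)%:R.
  have := l_s j; rewrite [l j.+1]ellS.
  have : radius q alpha (nn j.+1) `^ s <= 1.
    rewrite -(powRr0 (radius q alpha (nn j.+1))); apply: ger_powR => //.
    by rewrite r_le1 radius_gt0.
  have : 0 < l j * (L j.+1)%:R by rewrite mulr_gt0// ltr0n.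
  move: (l j * _) (radius _ _ _ `^ s) => X p X0 p1 Xp; nra.
have l_lim e : 0 < e -> exists j, l j <= e.
  move=> e0; have : geometric 1 2^-1 @ \oo --> (0 : R).
    by apply: cvg_geometric; rewrite ger0_norm// invf_lt1// ltr1n.
  move=> /cvgrPdist_le/(_ _ e0)[N _ /(_ (nn N.+1))] /=.
  rewrite sub0r normrN mul1r ger0_norm ?exprn_ge0// => H; exists N.+1.
  rewrite /l ellS (le_trans (radius_half q2 a0 _))// H//.
  by rewrite (leq_trans (leqnSn N)).
have stageD x : (forall j, stage L l j x) -> D_infty q alpha (\pi_(circle R) x).
  (* Level M + 1 avoids the root; scaling by L takes [k / L, k / L + r] to
     [k, k + exp (- alpha)]. *)
  move=> xs; apply/infinite_natP => M; exists (nn M.+1).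
    by rewrite (leq_trans (leqnSn M)).
  split; first by rewrite (leq_ltn_trans _ (nn_lt M)).
  rewrite /T_iter circle_norm_muln -/(L M.+1).
  have [k _] := xs M.+1; rewrite /left_end /l ellS /radius -/(L M.+1) -mulrDl.
  rewrite ler_pdivrMr ?ltr0n// ler_pdivlMr ?ltr0n// => /andP[h1 h2].
  apply: (le_trans (int_dist_le _ k)).
  rewrite -mulr_natr -pmulrn ger0_norm ?subr_ge0//.
  by rewrite lerBlDl.
have : (hausdorff_premeasure s 1 (D_infty q alpha) < (104^-1)%:E)%E.
  apply: (@le_lt_trans _ _ 0%E); last by rewrite lte_fin invr_gt0.
  by rewrite -Hs0; apply: ereal_sup_ubound; exists 1 => //=.
move=> /ereal_inf_lt[_ [U [DU U1] <-] Usum].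
pose p i := fine (diam_pow s (U i)).
have pE i : (p i)%:E = diam_pow s (U i).
  apply: fineK; rewrite ge0_fin_numE ?diam_pow_ge0//.
  by apply: (le_lt_trans (diam_pow_le s0 ler01 (U1 i))); rewrite ltry.
have p0 i : 0 <= p i by rewrite fine_ge0// diam_pow_ge0.
pose e i : R := 2^-1 ^+ i.+1 / 52.
have e0 i : 0 < e i by rewrite divr_gt0// exprn_gt0.
pose w i := 13 * (2 * p i + e i).
(* [B i] holds the centre and radius of a ball containing the lifts of [U i] to [0, 1/2]; if there
   are none it is (0, 0), an empty ball. *)
have /choice[B HB] : forall i, exists B : R * R,
    (0 < B.2 -> 13 * B.2 `^ s <= w i) /\
    (forall x, 0 <= x <= 2^-1 -> U i (\pi_(circle R) x) -> `|x - B.1| < B.2).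
  move=> i; case: (pselect (exists y, 0 <= y <= 2^-1 /\ U i (\pi_(circle R) y))); last first.
    move=> H; exists (0, 0) => /=; split; first by rewrite ltxx.
    by move=> x x2 Ux; exfalso; apply: H; exists x.
  move=> [y [y2 Uy]].
  have := pE i; rewrite /diam_pow; case: asboolP => [U0|_]; first by rewrite U0 in Uy.
  have := diam_ge0 Uy; case E : (diam (U i)) (U1 i) => [d| |]// _.
  rewrite lee_fin => d0 [pd].
  have [rho drho rhos] := powR_enlarge s01 d0 (e0 i).
  exists (y, rho) => /=; split; first by rewrite /w pd ler_pM2l.
  move=> x x2 Ux; apply: le_lt_trans drho.
  rewrite -lee_fin -E (le_trans _ (mdist_le_diam Ux Uy))// lee_fin.
  apply: (@le_trans _ _ (int_dist (x - y))); last first.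
    by rewrite -circle_dist_pi.
  by apply: norm_le_int_dist; rewrite ler_norml; lra.
have w0 i : 0 <= w i by rewrite mulr_ge0// addr_ge0 ?mulr_ge0// ltW.
have [||n] := @cover_weight_ge1 R L l L_gt0 L_dvd l_gt0 l_le lL_ge1 (erefl _) l_lim s
  (fun i => (B i).1) (fun i => (B i).2) w s01 l_s w0.
- by move=> i; case: (HB i).
- move=> x xs; have [i _ Ui] := DU _ (stageD x xs).
  exists i; case: (HB i) => _; apply=> //.
  by have := xs 0%N; rewrite (@stage0 R L l).
apply/negP; rewrite -ltNge /w -mulr_sumr big_split /= -mulr_sumr -mulr_suml.
have : \sum_(i < n) p i < 104^-1.
  rewrite -lte_fin -sumEFin (le_lt_trans _ Usum)//.
  rewrite -(big_mkord xpredT (fun i => (p i)%:E)).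
  under eq_bigr do rewrite pE.
  by apply: nneseries_lim_ge => i _ _; exact: diam_pow_ge0.
have := @sum_half_lt1 R n; lra.
Qed.

Lemma hausdorff_dim_D_infty : hausdorff_dim (D_infty q alpha) = bQ q alpha.
Proof.
apply/eqP; rewrite eq_le; apply/andP; split.
  rewrite bQ_inf//; apply: ereal_inf_le_tmp => _ [t [t0 Pt] <-].
  exists t => //; split=> //; exact: hausdorff_measure_D_infty0.
apply: le_ereal_inf_tmp => _ [s [s0 Hs] <-]; rewrite leNgt; apply/negP => sb.
by have := hausdorff_measure_D_infty_neq0 s0 sb; rewrite Hs eqxx.
Qed.

End LowerBound.

Theorem theorem1p1 (R : realType) (q : nat -> nat) (alpha : nat -> R) :
  (forall n, (1 <= n)%N -> (2 <= q n)%N) ->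
  (forall n, (1 <= n)%N -> 0 <= alpha n) ->
  hausdorff_dim (D_infty q alpha) = bQ q alpha /\
  bQ q alpha =
    limn_esup (fun n => (ln (qprod q n)%:R
                         / (ln (qprod q n)%:R + alpha_sum alpha n))%:E).
Proof.
by move=> q2 a0; split; [exact: hausdorff_dim_D_infty|exact: bQ_limn_esup].
Qed.
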